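(* Let $A=\begin{bmatrix} a & b\\ c& d\end{bmatrix}$ be a $2\times 2$ matrix with entries in the quaternions $\mathbb{H}$, with $b\neq 0$. Put $a_0=-b^{-1}c$, $a_1=b^{-1}(a-d)$ and $\Delta=a_1^2-4a_0$. Let $\mu\colon\mathbb{H}\to\mathbb{H}$ be the map $\mu(\lambda)=c-(d-\lambda)b^{-1}(a-\lambda)$, and let $\lambda\in\mathbb{H}$ be a left eigenvalue of $A$. If the differential $\mu_{*\lambda}$ has rank $0$, then $a_0$ and $a_1$ are real numbers and $\Delta=0$. Moreover $\lambda=(a+d)/2$, and this is the only left eigenvalue of $A$.
   Context: $\mathbb{H}$ denotes the quaternions, identified as a manifold with $\mathbb{R}^4$. A quaternion $\lambda$ is a left eigenvalue of a square quaternionic matrix $A$ if $A-\lambda\,\mathrm{Id}$ is not invertible. For $b\ne 0$, the left eigenvalues of the $2\times2$ quaternionic matrix $A=\begin{bmatrix} a & b\\ c& d\end{bmatrix}$ are exactly the zeros of the map $\mu(\lambda)=c-(d-\lambda)b^{-1}(a-\lambda)$. The differential of $\mu$ at $\lambda$ is the $\mathbb{R}$-linear map $\mu_{*\lambda}\colon\mathbb{H}\to\mathbb{H}$, $\mu_{*\lambda}(X)=Xb^{-1}(a-\lambda)+(d-\lambda)b^{-1}X$; its rank is its rank as a real linear map. *)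

(* Defs.v *)
From HB Require Import structures.
From mathcomp Require Import all_boot all_order all_algebra.
From mathcomp Require Import ring lra.
From mathcomp Require Import all_classical all_reals all_analysis.

Set Implicit Arguments.
Unset Strict Implicit.
Unset Printing Implicit Defensive.

Import Order.TTheory GRing.Theory Num.Theory.
Import numFieldNormedType.Exports.

Local Open Scope ring_scope.

(* The row [x0 x1 x2 x3] stands for x0 + x1 i + x2 j + x3 k, so that the
   topology and the real vector space structure are those of R^4. *)
Definition quat (R : realType) : Type := 'rV[R]_4.

HB.instance Definition _ (R : realType) := NormedModule.copy (quat R) 'rV[R]_4.
HB.instance Definition _ (R : realType) := Vector.copy (quat R) 'rV[R]_4.

Section QuaternionAlgebra.
Variable R : realType.
Implicit Types p q r : quat R.

Definition mkq (x0 x1 x2 x3 : R) : quat R :=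
  \row_(i < 4) [:: x0; x1; x2; x3]`_i.

Definition q0 q : R := (q : 'rV[R]_4) ord0 (@Ordinal 4 0 isT).
Definition q1 q : R := (q : 'rV[R]_4) ord0 (@Ordinal 4 1 isT).
Definition q2 q : R := (q : 'rV[R]_4) ord0 (@Ordinal 4 2 isT).
Definition q3 q : R := (q : 'rV[R]_4) ord0 (@Ordinal 4 3 isT).

Lemma q0_mk x0 x1 x2 x3 : q0 (mkq x0 x1 x2 x3) = x0.
Proof. by rewrite /q0 /mkq mxE. Qed.
Lemma q1_mk x0 x1 x2 x3 : q1 (mkq x0 x1 x2 x3) = x1.
Proof. by rewrite /q1 /mkq mxE. Qed.
Lemma q2_mk x0 x1 x2 x3 : q2 (mkq x0 x1 x2 x3) = x2.
Proof. by rewrite /q2 /mkq mxE. Qed.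
Lemma q3_mk x0 x1 x2 x3 : q3 (mkq x0 x1 x2 x3) = x3.
Proof. by rewrite /q3 /mkq mxE. Qed.
Definition q_mk := (q0_mk, q1_mk, q2_mk, q3_mk).

Lemma qP p q :
  q0 p = q0 q -> q1 p = q1 q -> q2 p = q2 q -> q3 p = q3 q -> p = q.
Proof.
move=> e0 e1 e2 e3; apply/rowP => -[[|[|[|[|//]]]] lti].
- by rewrite (bool_irrelevance lti isT).
- by rewrite (bool_irrelevance lti isT).
- by rewrite (bool_irrelevance lti isT).
- by rewrite (bool_irrelevance lti isT).
Qed.

Lemma q_add p q :
  ((q0 (p + q) = q0 p + q0 q)%R * (q1 (p + q) = q1 p + q1 q)%R *
   (q2 (p + q) = q2 p + q2 q)%R * (q3 (p + q) = q3 p + q3 q)%R)%type.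
Proof. by rewrite /q0 /q1 /q2 /q3 !mxE. Qed.

Lemma q_zero : ((q0 0 = 0) * (q1 0 = 0) * (q2 0 = 0) * (q3 0 = 0))%type.
Proof. by rewrite /q0 /q1 /q2 /q3 !mxE. Qed.

Lemma q_scale (x : R) q :
  ((q0 (x *: q) = x * q0 q)%R * (q1 (x *: q) = x * q1 q)%R *
   (q2 (x *: q) = x * q2 q)%R * (q3 (x *: q) = x * q3 q)%R)%type.
Proof. by rewrite /q0 /q1 /q2 /q3 !mxE. Qed.

Definition oneq : quat R := mkq 1 0 0 0.

Definition mulq p q : quat R := mkq
  (q0 p * q0 q - q1 p * q1 q - q2 p * q2 q - q3 p * q3 q)
  (q0 p * q1 q + q1 p * q0 q + q2 p * q3 q - q3 p * q2 q)
  (q0 p * q2 q - q1 p * q3 q + q2 p * q0 q + q3 p * q1 q)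
  (q0 p * q3 q + q1 p * q2 q - q2 p * q1 q + q3 p * q0 q).

Lemma mulqA : associative mulq.
Proof. by move=> p q r; apply: qP; rewrite /mulq !q_mk; ring. Qed.
Lemma mul1q : left_id oneq mulq.
Proof. by move=> p; apply: qP; rewrite /mulq /oneq !q_mk; ring. Qed.
Lemma mulq1 : right_id oneq mulq.
Proof. by move=> p; apply: qP; rewrite /mulq /oneq !q_mk; ring. Qed.
Lemma mulqDl : left_distributive mulq +%R.
Proof. by move=> p q r; apply: qP; rewrite /mulq !q_add !q_mk; ring. Qed.
Lemma mulqDr : right_distributive mulq +%R.
Proof. by move=> p q r; apply: qP; rewrite /mulq !q_add !q_mk; ring. Qed.
Lemma oneq_neq0 : oneq != 0.
Proof.
apply/eqP => /(congr1 q0); rewrite /oneq q_mk q_zero => /eqP.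
by rewrite oner_eq0.
Qed.

HB.instance Definition _ := GRing.Zmodule_isNzRing.Build (quat R)
  mulqA mul1q mulq1 mulqDl mulqDr oneq_neq0.

Lemma mulqE p q : p * q = mulq p q. Proof. by []. Qed.
Lemma oneqE : 1 = oneq :> quat R. Proof. by []. Qed.

Lemma scaleqAl (x : R) p q : x *: (p * q) = (x *: p) * q.
Proof. by apply: qP; rewrite !mulqE /mulq !(q_scale, q_mk); ring. Qed.
Lemma scaleqAr (x : R) p q : x *: (p * q) = p * (x *: q).
Proof. by apply: qP; rewrite !mulqE /mulq !(q_scale, q_mk); ring. Qed.

HB.instance Definition _ :=
  GRing.Lmodule_isLalgebra.Build R (quat R) scaleqAl.
HB.instance Definition _ :=
  GRing.Lalgebra_isAlgebra.Build R (quat R) scaleqAr.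

Definition conjq q : quat R := mkq (q0 q) (- q1 q) (- q2 q) (- q3 q).

Definition sqnormq q : R := q0 q ^+ 2 + q1 q ^+ 2 + q2 q ^+ 2 + q3 q ^+ 2.

Definition invq q : quat R := (sqnormq q)^-1 *: conjq q.

Lemma sqnormq_eq0 q : (sqnormq q == 0) = (q == 0).
Proof.
apply/eqP/eqP => [|->]; last by rewrite /sqnormq !q_zero; ring.
move=> /eqP; rewrite /sqnormq !paddr_eq0 ?addr_ge0 ?sqr_ge0// !sqrf_eq0.
by case/andP => /andP[/andP[/eqP e0 /eqP e1] /eqP e2] /eqP e3;
  apply: qP; rewrite q_zero.
Qed.

Lemma mulVq : {in [pred q | q != 0], left_inverse 1 invq *%R}.
Proof.
move=> q; rewrite inE -sqnormq_eq0 => nq.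
rewrite /invq -scalerAl.
by apply: qP; rewrite oneqE mulqE q_scale /mulq /conjq /oneq !q_mk;
  move: nq; rewrite /sqnormq => nq; field.
Qed.

Lemma mulqV : {in [pred q | q != 0], right_inverse 1 invq *%R}.
Proof.
move=> q; rewrite inE -sqnormq_eq0 => nq.
rewrite /invq -scalerAr.
by apply: qP; rewrite oneqE mulqE q_scale /mulq /conjq /oneq !q_mk;
  move: nq; rewrite /sqnormq => nq; field.
Qed.

Lemma unitqP p q : q * p = 1 /\ p * q = 1 -> p \in [pred q | q != 0].
Proof.
move=> [_ pq1]; rewrite inE; apply/eqP => p0.
by move: pq1; rewrite p0 mul0r => /esym/eqP; rewrite oner_eq0.
Qed.

Lemma invq_out : {in [predC [pred q | q != 0]], invq =1 id}.
Proof.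
move=> q; rewrite !inE negbK => /eqP ->.
by apply: qP; rewrite /invq q_scale /conjq q_mk q_zero ?oppr0 mulr0.
Qed.

HB.instance Definition _ := GRing.NzRing_hasMulInverse.Build (quat R)
  mulVq mulqV unitqP invq_out.

Definition qreal q : Prop := exists x : R, q = x%:A.

End QuaternionAlgebra.

(* [unitmx] requires commutative entries, whence the explicit two-sided inverse. *)
Definition mx_invertible (S : nzRingType) (n : nat) (M : 'M[S]_n) : Prop :=
  exists N : 'M[S]_n, M *m N = 1%:M /\ N *m M = 1%:M.

Definition left_eigenvalue (R : realType) (n : nat) (A : 'M[quat R]_n)
    (lambda : quat R) : Prop :=
  ~ mx_invertible (A - lambda%:M).

Definition mu (R : realType) (a b c d lambda : quat R) : quat R :=
  c - (d - lambda) * b^-1 * (a - lambda).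

(* Real rank of the differential at x. *)
Definition diff_rank (R : realType) (f : quat R -> quat R) (x : quat R) : nat :=
  \dim (limg (linfun ('d f x))).

(* Main.v *)
From HB Require Import structures.
Require Import Defs.
From mathcomp Require Import all_boot all_order all_algebra.
From mathcomp Require Import all_classical all_reals all_analysis.
From mathcomp Require Import lra.
Import Order.TTheory GRing.Theory Num.Theory numFieldNormedType.Exports.
Local Open Scope ring_scope.

Set Implicit Arguments.
Unset Strict Implicit.
Unset Printing Implicit Defensive.

(** The matrix A - lambda Id has the invertible upper right entry b, so
elimination reduces its invertibility to that of the Schur complement
mu(lambda); hence left eigenvalues are zeros of mu ([left_eigenvalue_mu]).

Write p = b^-1 (a - lambda) and q = (d - lambda) b^-1. The expansion
  mu(lambda + x) = mu(lambda) + (x p + q x) - x b^-1 x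
is exact ([mu_add]). Its last term is quadratic in x, so that x p + q x is the
differential at lambda ([diff_mu]). If this differential has rank 0, then
x = 1 gives q = -p, whence p commutes with every x and is real
([quat_center_real]). Consequently a - lambda = b p and d - lambda = - b p:
adding these relations gives lambda = (a + d) / 2, subtracting them gives
a1 = 2 p, and mu(lambda) = 0 becomes c = - b p^2, that is a0 = p^2. So a0 and
a1 are real and Delta = (2 p)^2 - 4 p^2 = 0.

The same expansion yields uniqueness: if mu also vanishes at lambda + x, then
both the constant and the linear term are zero, so x b^-1 x = 0 and x = 0. *)

Lemma quat_unitE (R : realType) (p : quat R) : (p \is a GRing.unit) = (p != 0).
Proof. by []. Qed.

Lemma quat_mulf_eq0 (R : realType) (p q : quat R) :
  (p * q == 0) = (p == 0) || (q == 0).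
Proof.
have [->|p0] := eqVneq p 0; first by rewrite mul0r eqxx.
by rewrite -{1}(mulr0 p) (inj_eq (mulrI _)) ?quat_unitE.
Qed.

(** Commuting with i kills the j and k components, and commuting with j kills
the i component. *)
Lemma quat_center_real (R : realType) (p : quat R) :
  (forall x, x * p = p * x) -> qreal p.
Proof.
move=> pC; exists (q0 p).
have pi := pC (mkq 0 1 0 0); have pj := pC (mkq 0 0 1 0).
have := congr1 (@q2 R) pi; have := congr1 (@q3 R) pi; have := congr1 (@q3 R) pj.
rewrite !mulqE /mulq !q_mk => e1 e2 e3.
by apply: qP; rewrite !q_scale oneqE /oneq !q_mk; lra.
Qed.

Lemma quat_norm_coord (R : realType) (p : quat R) i :
  `|(p : 'rV[R]_4) ord0 i| <= `|p|.
Proof.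
rewrite [X in _ <= X]/Num.norm/= mx_normrE.
exact: (le_bigmax _ (fun ij => `|(p : 'rV[R]_4) ij.1 ij.2|) (ord0, i)).
Qed.

Lemma quat_norm_le (R : realType) (p : quat R) (e : R) : 0 <= e ->
  `|q0 p| <= e -> `|q1 p| <= e -> `|q2 p| <= e -> `|q3 p| <= e -> `|p| <= e.
Proof.
move=> e_ge0 h0 h1 h2 h3.
rewrite [X in X <= _]/Num.norm/= mx_normrE.
apply/bigmax_leP; split=> // -[i [[|[|[|[|//]]]] ltj]] _ /=; rewrite (ord1 i).
- by move: h0; rewrite /q0 (bool_irrelevance ltj isT).
- by move: h1; rewrite /q1 (bool_irrelevance ltj isT).
- by move: h2; rewrite /q2 (bool_irrelevance ltj isT).
- by move: h3; rewrite /q3 (bool_irrelevance ltj isT).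
Qed.

(** The norm is the largest absolute value of a coordinate, which is not
multiplicative; each coordinate of a product is a signed sum of four products
of coordinates, which accounts for the factor 4. *)
Lemma quat_normM_le (R : realType) (p q : quat R) :
  `|p * q| <= 4 * `|p| * `|q|.
Proof.
have coordM i j :
    `|(p : 'rV[R]_4) ord0 i * (q : 'rV[R]_4) ord0 j| <= `|p| * `|q|.
  by rewrite normrM ler_pM// quat_norm_coord.
have sum4 (x y z t e : R) : `|x| <= e -> `|y| <= e -> `|z| <= e -> `|t| <= e ->
    `|x + y + z + t| <= 4 * e.
  rewrite !ler_norml; lra.
have sub (x e : R) : `|x| <= e -> `|- x| <= e by rewrite normrN.
rewrite -mulrA; apply: quat_norm_le; first by rewrite !mulr_ge0.
all: rewrite mulqE /mulq q_mk; apply: sum4.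
all: by do ?apply: sub; apply: coordM.
Qed.

Definition bimulq (R : realType) (p q x : quat R) : quat R := x * p + q * x.

Lemma bimulq_is_linear (R : realType) (p q : quat R) : linear (bimulq p q).
Proof.
move=> k x y.
by rewrite /bimulq mulrDl mulrDr -scalerAl -(scalerAr k q) addrACA -scalerDr.
Qed.

HB.instance Definition _ (R : realType) (p q : quat R) :=
  GRing.isLinear.Build R (quat R) (quat R) _ (bimulq p q)
    (bimulq_is_linear p q).

Lemma bimulq_continuous (R : realType) (p q : quat R) :
  continuous (bimulq p q).
Proof.
apply/bounded_linear_continuous/bounded_funP => r.
exists (4 * r * `|p| + 4 * `|q| * r) => x xr.
rewrite (le_trans (ler_normD _ _))// lerD//.
  by rewrite (le_trans (quat_normM_le _ _))// ler_wpM2r// ler_wpM2l.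
by rewrite (le_trans (quat_normM_le _ _))// ler_wpM2l// mulr_ge0.
Qed.

(** Exact second-order expansion, [mu] being quadratic. *)
Lemma mu_add (R : realType) (a b c d lambda x : quat R) :
  mu a b c d (x + lambda) = mu a b c d lambda
    + bimulq (b^-1 * (a - lambda)) ((d - lambda) * b^-1) x - x * b^-1 * x.
Proof.
have shift (e : quat R) : e - (x + lambda) = (e - lambda) - x.
  by rewrite opprD addrA addrAC.
rewrite /mu /bimulq !shift; move: (a - lambda) (d - lambda) => u v.
rewrite !mulrBl !mulrBr !opprB !mulrA.
by rewrite [LHS](AC (1*(2*2)) ((1*5)*(2*4)*3)).
Qed.

Lemma diff_mu (R : realType) (a b c d lambda : quat R) :
  'd (mu a b c d) lambda = bimulq (b^-1 * (a - lambda)) ((d - lambda) * b^-1)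
    :> (quat R -> quat R).
Proof.
apply: diff_unique; first exact: bimulq_continuous.
apply/eqaddoP => e e0 /=.
(* Two uses of the submultiplicativity bound give
   |x b^-1 x| <= 4 (4 |x| |b^-1|) |x|; the summand 1 makes K positive. *)
pose K := 16 * `|b^-1| + 1.
have K0 : 0 < K by rewrite ltr_wpDl// mulr_ge0.
have small : \forall x \near (0 : quat R), `|x| <= e / K.
  apply/nbhs_normP; exists (e / K) => /=; first by rewrite divr_gt0.
  by move=> x /=; rewrite sub0r normrN => /ltW.
near=> x.
have xs : `|x| <= e / K by near: x.
have -> : (mu a b c d \o shift lambda - (cst (mu a b c d lambda)
    + bimulq (b^-1 * (a - lambda)) ((d - lambda) * b^-1))) x
    = - (x * b^-1 * x).
  rewrite !fctE /= mu_add.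
  by rewrite addrAC subrr add0r.
rewrite normrN (le_trans (quat_normM_le _ _))//= ler_wpM2r//.
rewrite (@le_trans _ _ (K * `|x|))//; last by rewrite mulrC -ler_pdivlMr.
have := quat_normM_le x b^-1; rewrite /K; have := normr_ge0 x.
lra.
Unshelve. all: by end_near. Qed.

Lemma diff_rank_eq0 (R : realType) (f : quat R -> quat R) (x : quat R) :
  diff_rank f x = 0%N -> forall y, 'd f x y = 0.
Proof.
move=> /eqP; rewrite /diff_rank dimv_eq0 => /eqP img0 y.
have := memv_img (linfun ('d f x)) (memvf y).
by rewrite img0 memv0 lfunE => /eqP.
Qed.

Lemma mx2P (S : Type) (M N : 'M[S]_2) :
  M 0 0 = N 0 0 -> M 0 1 = N 0 1 -> M 1 0 = N 1 0 -> M 1 1 = N 1 1 -> M = N.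
Proof.
move=> e00 e01 e10 e11; apply/matrixP.
have ord2 (i : 'I_2) : i = 0 \/ i = 1.
  by case: i => [[|[|//]] lti]; [left | right]; apply: val_inj.
by move=> i j; case: (ord2 i) (ord2 j) => -> [] ->.
Qed.

Lemma mulmx2E (S : pzRingType) (M N : 'M[S]_2) i j :
  (M *m N) i j = M i 0 * N 0 j + M i 1 * N 1 j.
Proof.
rewrite mxE !big_ord_recl big_ord0 addr0.
by rewrite (_ : lift ord0 ord0 = 1)//; apply: val_inj.
Qed.

(** Elimination with the pivot [M 0 1]: with r and s as in the proof, M sends
(x, y) to (u, v) exactly when y = b^-1 u - r x and m x = v - s u, where m is the
Schur complement; solving for x and then y gives the inverse. *)
Lemma mx2_invertible (S : unitRingType) (M : 'M[S]_2) :
  M 0 1 \is a GRing.unit ->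
  M 1 0 - M 1 1 * (M 0 1)^-1 * M 0 0 \is a GRing.unit -> mx_invertible M.
Proof.
move e01: (M 0 1) => b; set m := _ - _ => bU mU.
set r := b^-1 * M 0 0; set s := M 1 1 * b^-1.
have pE : M 0 0 = b * r by rewrite mulVKr.
have qE : M 1 1 = s * b by rewrite mulrVK.
have cE : M 1 0 = m + s * b * r by rewrite -qE mulrA subrK.
clearbody r s m.
exists (\matrix_(i, j) if i == 0 then if j == 0 then - (m^-1 * s) else m^-1
       else if j == 0 then b^-1 + r * m^-1 * s else - (r * m^-1)).
split; apply: mx2P; rewrite mulmx2E !mxE/= ?(pE, qE, e01, cE).
all: rewrite !(mulrDl, mulrDr, mulrN, mulNr, mulrA, mulrV, mulVr, mul1r,
               mulrK, mulrVK)//.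
all: by rewrite -?opprD ?(subrr, addNr, addrK)// addrC addrK.
Qed.

Lemma left_eigenvalue_mu (R : realType) (A : 'M[quat R]_2) (lambda : quat R) :
  A 0 1 != 0 -> left_eigenvalue A lambda ->
  mu (A 0 0) (A 0 1) (A 1 0) (A 1 1) lambda = 0.
Proof.
move=> b0 eigA; apply/eqP/negPn/negP => mu0; apply: eigA.
by apply: mx2_invertible; rewrite !mxE/= ?mulr1n ?mulr0n ?subr0 quat_unitE.
Qed.

Theorem proposition28 (R : realType) (A : 'M[quat R]_2) (lambda : quat R) :
  let a := A 0 0 in
  let b := A 0 1 in
  let c := A 1 0 in
  let d := A 1 1 in
  let a0 := - (b^-1 * c) in
  let a1 := b^-1 * (a - d) in
  let Delta := a1 ^+ 2 - 4 * a0 in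
  b != 0 ->
  left_eigenvalue A lambda ->
  diff_rank (mu a b c d) lambda = 0%N ->
  [/\ qreal a0, qreal a1, Delta = 0, lambda = (a + d) / 2
    & forall lambda' : quat R, left_eigenvalue A lambda' -> lambda' = lambda].
Proof.
move=> a b c d a0 a1 Delta b0 /(left_eigenvalue_mu b0).
rewrite -/a -/b -/c -/d => mu0 /diff_rank_eq0 d0.
have bU : b \is a GRing.unit by [].
set p := b^-1 * (a - lambda); set q := (d - lambda) * b^-1.
have pq0 x : x * p + q * x = 0 by have := d0 x; rewrite diff_mu.
have qE : q = - p.
  by apply/eqP; rewrite -addr_eq0 addrC -(pq0 1) mul1r mulr1.
have [t pE] : qreal p.
  apply: quat_center_real => x.
  by apply/eqP; rewrite -subr_eq0 -mulNr -qE pq0.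
have pC x : p * x = x * p by rewrite pE mulr_algl mulr_algr.
have aE : a - lambda = b * p by rewrite mulVKr.
have dE : d - lambda = - (b * p) by rewrite -(mulrVK bU (d - _)) -/q qE mulNr pC.
have a0E : a0 = p * p.
  have cE : c = q * (a - lambda) by apply/eqP; rewrite -subr_eq0 -mu0.
  by rewrite /a0 cE qE aE mulNr mulrN opprK pC -mulrA mulKr.
have a1E : a1 = p *+ 2.
  by rewrite /a1 -(subrKA lambda) -(opprB d) aE dE opprK -mulrDr mulKr// mulr2n.
split.
- by exists (t * t); rewrite a0E pE -scalerAl mul1r scalerA.
- by exists (t *+ 2); rewrite a1E pE scalerMnl.
- by rewrite /Delta a0E a1E exprMn_n mulr_natl subrr.
- have twoU : (2 : quat R) \is a GRing.unit.
    by rewrite quat_unitE -scaler_nat scaler_eq0 pnatr_eq0 oner_eq0.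
  apply: (mulIr twoU); rewrite mulrVK// mulr_natr mulr2n.
  by rewrite -[a](subrK lambda) -[d](subrK lambda) aE dE addrACA subrr add0r.
(* Here the expansion is used at x = lambda' - lambda. *)
move=> lambda' /(left_eigenvalue_mu b0); rewrite -/a -/b -/c -/d.
rewrite -{1}(subrK lambda lambda') mu_add mu0 add0r /bimulq -/p -/q pq0 sub0r.
move=> /eqP; rewrite oppr_eq0 !quat_mulf_eq0 -[b^-1 == 0]negbK.
rewrite -quat_unitE unitrV bU orbF orbb.
by rewrite subr_eq0 => /eqP.
Qed.
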